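(* If an ideal $\mathcal{I}$ on $\omega$ has the Baire property, then $\mathfrak{b}(\mathcal{I},\mathrm{Fin},\mathrm{Fin})=\mathfrak{b}$.
   Context: An ideal on $\omega$ is a family $\mathcal{I}\subseteq\mathcal{P}(\omega)$ closed under finite unions and subsets, containing all finite sets, with $\omega\notin\mathcal{I}$; $\mathrm{Fin}$ is the ideal of finite subsets of $\omega$. $\mathcal{P}(\omega)$ is identified with the Cantor space $\{0,1\}^\omega$ via characteristic functions, and an ideal has the Baire property if it does as a subset of this space. $\mathfrak{b}$ is the bounding number (least size of a $\le^*$-unbounded subset of $\omega^\omega$). For an ideal $\mathcal{K}$, $\widehat{\mathcal{P}}_{\mathcal{K}}$ is the family of sequences $\langle A_n:n\in\omega\rangle$ of pairwise disjoint members of $\mathcal{K}$, and $\mathcal{P}_{\mathcal{K}}$ those with $\bigcup_nA_n=\omega$. For ideals $\mathcal{I},\mathcal{J},\mathcal{K}$: $\mathfrak{b}(\mathcal{I},\mathcal{J},\mathcal{K})=\min\{|\mathcal{E}|:\mathcal{E}\subseteq\widehat{\mathcal{P}}_{\mathcal{K}},\ \forall\langle A_n\rangle\in\mathcal{P}_{\mathcal{J}}\ \exists\langle E_n\rangle\in\mathcal{E}\ \bigcup_n(A_n\cap\bigcup_{i\le n}E_i)\notin\mathcal{I}\}$ (with $\min\emptyset=\mathfrak{c}^+$). Equivalently $\mathfrak{b}(\mathcal{I},\mathrm{Fin},\mathrm{Fin})$ is the least size of a family of finite-to-one functions not bounded from below, modulo $\mathcal{I}$ with strict inequality, by any finite-to-one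 function. *)

(* Defs.v *)
From mathcomp Require Import all_boot all_order all_algebra.
From mathcomp Require Import all_classical all_reals all_analysis.

Set Implicit Arguments.
Unset Strict Implicit.
Unset Printing Implicit Defensive.

Local Open Scope classical_set_scope.
Local Open Scope card_scope.

Record is_ideal (I : set (set nat)) : Prop := IsIdeal {
  ideal_setU : forall A B, I A -> I B -> I (A `|` B) ;
  ideal_subset : forall A B, A `<=` B -> I B -> I A ;
  ideal_finite : forall A, finite_set A -> I A ;
  ideal_proper : ~ I [set: nat] }.

Definition Fin : set (set nat) := [set A | finite_set A].

Definition nowhere_dense (T : topologicalType) (A : set T) : Prop :=
  interior (closure A) = set0.

Definition meager (T : topologicalType) (A : set T) : Prop :=
  exists2 F : nat -> set T,
    forall n, nowhere_dense (F n) & A = \bigcup_n F n.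

Definition baire_property (T : topologicalType) (A : set T) : Prop :=
  exists2 U : set T, open U & meager ((A `\` U) `|` (U `\` A)).

(* A family of subsets of nat seen in {0,1}^nat through characteristic
   functions. *)
Definition in_cantor (I : set (set nat)) : set cantor_space :=
  [set x | I [set n | x n = true]].

(* There is no type of cardinals in the library, only the relations #<= and #=,
   so a cardinal number is represented by any set k of that size, and a cardinal
   invariant by the predicate "k has that size". *)

Definition is_min_card (T : Type) (W : set (set T)) (U : Type) (k : set U)
    : Prop :=
  exists E : set T, [/\ W E, forall E', W E' -> E #<= E' & k #= E].

(* |k| = c^+ *)
Definition is_succ_continuum (U : Type) (k : set U) : Prop :=
  ~ (k #<= [set: set nat]) /\
  forall (V : Type) (l : set V), ~ (l #<= [set: set nat]) -> k #<= l.

Definition le_star (f g : nat -> nat) : Prop :=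
  \forall n \near \oo, (f n <= g n)%N.

Definition star_unbounded (F : set (nat -> nat)) : Prop :=
  ~ exists g : nat -> nat, forall f, F f -> le_star f g.

(* |k| = b *)
Definition is_b (U : Type) (k : set U) : Prop := is_min_card star_unbounded k.

Definition disjoint_seqs (K : set (set nat)) : set (nat -> set nat) :=
  [set A | (forall n, K (A n)) /\ trivIset setT A].

Definition partition_seqs (K : set (set nat)) : set (nat -> set nat) :=
  [set A | disjoint_seqs K A /\ \bigcup_n A n = [set: nat]].

Definition b3_witness (I J K : set (set nat)) : set (set (nat -> set nat)) :=
  [set E | E `<=` disjoint_seqs K /\
    forall A, partition_seqs J A ->
      exists2 e, E e &
        ~ I (\bigcup_n (A n `&` \bigcup_(i in [set i | (i <= n)%N]) e i))].

(* |k| = b(I, J, K), with the convention min(set0) = c^+ *)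
Definition is_b3 (I J K : set (set nat)) (U : Type) (k : set U) : Prop :=
  is_min_card (b3_witness I J K) k \/
  (b3_witness I J K = set0 /\ is_succ_continuum k).

(* Main.v *)
(* If g strictly increases and eventually dominates the functions bounding the
   members of finite unions e_0 u ... u e_n, then the partition of nat into the
   intervals [g n, g n.+1[ defeats every such e; hence b <= b(I, Fin, Fin) for
   any ideal. Conversely, the Baire property yields intervals P_k such that no
   member of I contains infinitely many of them. An unbounded family of
   strictly increasing f is then turned into a witness by letting e_i be the
   union of the P_k with f i <= k < f i.+1: given a partition A into finite
   sets, some f infinitely often escapes the speed at which A exhausts nat, and
   then P_(f i) lies in the union of the A_n with n >= i. *)
Require Import Defs.
From mathcomp Require Import all_boot all_order all_algebra.
From mathcomp Require Import all_classical all_reals all_analysis.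
From mathcomp Require Import zify.

Set Implicit Arguments.
Unset Strict Implicit.
Unset Printing Implicit Defensive.

Local Open Scope classical_set_scope.
Local Open Scope card_scope.

(** * Families of least cardinality *)

(* Hönig's argument: a maximal set of choice functions on W that pairwise
   differ at every member of W must exhaust some member of W. *)
Lemma ex_min_card (T : Type) (W : set (set T)) : W !=set0 ->
  exists2 E, W E & forall E', W E' -> E #<= E'.
Proof.
move=> [E0 WE0].
pose P (M : set (set T -> T)) := (forall p, M p -> forall E, W E -> E (p E)) /\
  forall p q, M p -> M q -> forall E, W E -> p E = q E -> p = q.
have [M [[Mch Minj] Mmax]] : exists M, P M /\ forall B, M `<` B -> ~ P B.
  apply: Zorn_bigcup => F FP Ftot; split=> [p [X FX Xp]|p q [X FX Xp] [Y FY Yq]].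
    by have [+ _] := FP _ FX; exact.
  have [XY|YX] := Ftot _ _ FX FY.
    by have [_ +] := FP _ FY; apply => //; exact: XY.
  by have [_ +] := FP _ FX; apply => //; exact: YX.
have [E WE Esurj] : exists2 E, W E & forall x, E x -> exists2 p, M p & p E = x.
  apply: contrapT => noE.
  (* Otherwise each member of [W] has a point that no function in [M] takes there; these points form
     a new choice function, against maximality. *)
  have fresh E : W E -> exists2 x, E x & forall p, M p -> p E <> x.
    move=> WE; apply: contrapT => nox; apply: noE; exists E => // x Ex.
    apply: contrapT => nop; apply: nox; exists x => // p Mp pEx.
    by apply: nop; exists p.
  have [x0 _ _] := fresh _ WE0.
  have /choice[q qP] E : exists x, W E -> E x /\ forall p, M p -> p E <> x.
    have [WE|nWE] := pselect (W E); last by exists x0.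
    by have [x Ex xP] := fresh _ WE; exists x.
  apply: (Mmax (M `|` [set q])); last first.
    split=> [p [Mp|->] E WE|p p' [Mp|->] [Mp'|->] E WE] //.
    - exact: (Mch _ Mp _ WE).
    - exact: (qP _ WE).1.
    - exact: (Minj _ _ Mp Mp' E).
    - by move=> /((qP _ WE).2 _ Mp).
    - by move=> /esym/((qP _ WE).2 _ Mp').
  split; first exact: subsetUl.
  by move=> /(_ q (or_intror erefl)) Mq; exact: (qP _ WE0).2 Mq erefl.
exists E => // E' WE'.
(* Evaluation at [E] maps [M] onto [E]; evaluation at [E'] embeds [M] into [E']. *)
have EM : E #<= M.
  apply: card_le_trans (card_image_le (fun p => p E) M).
  by apply: subset_card_le => x /Esurj[p Mp <-]; exists p.
apply: (card_le_trans EM).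
have inj : {in M &, injective (fun p : set T -> T => p E')}.
  by move=> p q /set_mem Mp /set_mem Mq; exact: Minj.
have := inj_card_eq inj; rewrite card_eq_le => /andP[_ /card_le_trans]; apply.
by apply: subset_card_le => _ [p Mp <-]; exact: (Mch _ Mp _ WE').
Qed.

(** * Increasing majorants and bounds for finite sets *)

Definition majorant (g : nat -> nat) (n : nat) : nat :=
  (\sum_(i < n.+1) (g i).+1)%N.

Lemma majorant_gt g n : (g n < majorant g n)%N.
Proof. by rewrite /majorant big_ord_recr /= leq_addl. Qed.

Lemma majorant_homo g : {homo majorant g : m n / (m < n)%N}.
Proof.
apply: homo_ltn; first exact: ltn_trans.
by move=> n; rewrite /majorant [ltnRHS]big_ord_recr /= addnS ltnS leq_addr.
Qed.

Lemma ltn_homo_le (f : nat -> nat) : {homo f : m n / (m < n)%N} ->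
  {homo f : m n / (m <= n)%N}.
Proof. by move=> fh m n; rewrite leq_eqVlt => /predU1P[->//|/fh/ltnW]. Qed.

Lemma ltn_homo_ge_id (f : nat -> nat) n :
  {homo f : m n / (m < n)%N} -> (n <= f n)%N.
Proof. by move=> fh; elim: n => // n IH; exact: leq_ltn_trans IH (fh _ _ _). Qed.

Lemma finite_nat_bounded (A : set nat) : finite_set A ->
  exists b, forall x, A x -> (x < b)%N.
Proof.
move=> /finite_seqP[X ->]; exists (\max_(i <- X) i).+1 => x /= xX.
by rewrite ltnS; exact: (leq_bigmax_seq (F := id)).
Qed.

Lemma finite_seq_bounded (e : nat -> set nat) : (forall n, finite_set (e n)) ->
  exists b : nat -> nat, forall n i x, (i <= n)%N -> e i x -> (x < b n)%N.
Proof.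
move=> fe; have /choice[c cP] n := finite_nat_bounded (fe n).
exists (majorant c) => n i x ni /cP /ltn_trans; apply.
apply: leq_trans (majorant_gt c i) _.
exact: (ltn_homo_le (@majorant_homo c)).
Qed.

Lemma star_unboundedT : star_unbounded [set: nat -> nat].
Proof.
move=> [g /(_ (fun n => (g n).+1) Logic.I)[N _ /(_ N (leqnn N))]] /=.
by rewrite ltnn.
Qed.

Lemma not_le_star f g : ~ le_star f g ->
  forall N, exists2 n, (N <= n)%N & (g n < f n)%N.
Proof.
move=> nfg N; apply: contrapT => non; apply: nfg; exists N => // n /= Nn.
by rewrite leqNgt; apply/negP => gf; apply: non; exists n.
Qed.

(** * The lower bound, for every ideal *)

Lemma star_unbounded_le_b3 (I : set (set nat)) E : is_ideal I ->
  b3_witness I Fin Fin E -> exists2 F, star_unbounded F & F #<= E.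
Proof.
move=> idealI [EFin Ewit].
have /choice[b bP] (e : nat -> set nat) : exists b : nat -> nat,
    E e -> forall n i x, (i <= n)%N -> e i x -> (x < b n)%N.
  have [/EFin[/finite_seq_bounded[b bP] _]|nEe] := pselect (E e).
    by exists b.
  by exists id.
exists (b @` E); last exact: card_image_le.
move=> [g gP]; set G := majorant g.
have Glt : {homo G : m n / (m < n)%N} by exact: majorant_homo.
have Gle := ltn_homo_le Glt.
(* The guard [0 < n] lets the first piece start at 0, so that nothing below [G 0] is left out. *)
pose A n := [set x | ((0 < n)%N -> (G n <= x)%N) /\ (x < G n.+1)%N].
have Apart : partition_seqs Fin A.
  split; [split=> [n|]|].
  - by apply: (@sub_finite_set _ _ `I_(G n.+1)) => // x [].
  - have lem i j x : A i x -> A j x -> (i <= j)%N.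
      move=> [Gi _] [_ xG]; rewrite leqNgt; apply/negP => ji.
      have := Gi (leq_ltn_trans (leq0n _) ji); rewrite leqNgt => /negP; apply.
      exact: leq_trans xG (Gle _ _ ji).
    move=> i j _ _ [x [Ai Aj]]; apply/eqP.
    by rewrite eqn_leq (lem _ _ _ Ai Aj) (lem _ _ _ Aj Ai).
  - apply/seteqP; split=> // x _.
    have ex : exists n, (x < G n.+1)%N by exists x; exact: ltn_homo_ge_id.
    have [n xG nmin] := ex_minnP ex; exists n => //; split=> // n0.
    rewrite leqNgt; apply/negP => xGn.
    by have := nmin n.-1; rewrite prednK// => /(_ xGn); rewrite leqNgt ltn_predL n0.
have [e Ee] := Ewit _ Apart; apply; apply: (ideal_finite idealI).
have [|N _ Nle] := gP (b e); first by exists e.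
(* Only pieces with [n <= N] contribute: beyond [N], a common point would satisfy
   [x < b e n <= g n < G n <= x]. *)
apply: (@sub_finite_set _ _ `I_(G N.+1)) => // x [n _ [[Gx xG] [i /= ni eix]]] /=.
apply: (leq_trans xG); apply: Gle; rewrite ltnS leqNgt; apply/negP => Nn.
have xb := bP _ Ee _ _ _ ni eix.
have bg := Nle n (ltnW Nn).
have := leq_trans (majorant_gt g n) (Gx (leq_ltn_trans (leq0n _) Nn)).
by rewrite ltnNge => /negP; apply; apply: ltnW; exact: leq_trans xb bg.
Qed.

(** * Avoiding nowhere dense sets in the Cantor space *)

Definition cylinder (x : cantor_space) (n : nat) : set cantor_space :=
  [set y | forall i, (i < n)%N -> y i = x i].

Lemma open_cylinder x n : open (cylinder x n).
Proof.
elim: n => [|n IH].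
  rewrite (_ : cylinder x 0 = setT); first exact: openT.
  by apply/seteqP; split.
rewrite (_ : cylinder x n.+1 =
    cylinder x n `&` (@proj nat (fun=> bool) n) @^-1` [set x n]).
  apply: openI => //; apply: open_comp; last exact: discrete_open.
  by move=> y _; exact: proj_continuous.
apply/seteqP; split=> [y yx|y [yx ynx] i].
  by split=> [i /ltnW/yx//|]; exact: yx.
by rewrite ltnS leq_eqVlt => /predU1P[->//|/yx].
Qed.

Lemma nbhs_cylinder (x : cantor_space) U : nbhs x U ->
  exists n, cylinder x n `<=` U.
Proof.
pose F := filter_from [set: nat] (cylinder x).
have FF : Filter F.
  apply: filter_from_filter; first by exists 0%N.
  move=> i j _ _; exists (maxn i j) => // y yx.
  by split=> k kij; apply: yx; rewrite leq_max kij ?orbT.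
suff : F --> x by move=> /[apply] -[n _ nU]; exists n.
(* The product topology is a supremum of initial topologies, so it suffices to test one coordinate
   [i] at a time; a cylinder of length [i.+1] fixes it. *)
apply/cvg_sup => i V [B [[W oW <-] /= Wx]] WV.
by exists i.+1 => // y yx; apply: WV => /=; rewrite /proj yx.
Qed.

Lemma nowhere_dense_avoid (F : set cantor_space) x n : nowhere_dense F ->
  exists y m, [/\ (n <= m)%N, cylinder x n y & cylinder y m `&` F = set0].
Proof.
move=> nwF.
have [y xy nFy] : exists2 y, cylinder x n y & ~ closure F y.
  apply: contrapT => noy; suff: interior (closure F) x by rewrite nwF.
  apply: (@filterS _ _ _ (cylinder x n)).
    by move=> y xy; apply: contrapT => nFy; apply: noy; exists y.
  by apply: open_nbhs_nbhs; split => //; exact: open_cylinder.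
have /nbhs_cylinder[m mF] : nbhs y (~` closure F).
  by apply: open_nbhs_nbhs; split => //; apply: closed_openC; exact: closed_closure.
exists y, (maxn n m); split=> //; first exact: leq_maxl.
apply/seteqP; split=> // z [zy Fz].
apply: (mF z); last exact: subset_closure.
by move=> i im; apply: zy; rewrite leq_max im orbT.
Qed.

Definition splice (n : nat) (s y : cantor_space) : cantor_space :=
  fun i => if (i < n)%N then s i else y i.

(** Requirements are met one at a time: the new tail keeps the old one on the bits from [n] to [m],
    which preserves the requirements met before. *)
Lemma nowhere_dense_avoid_prefixes (T : eqType) (r : seq T)
    (s : T -> cantor_space) (F : T -> set cantor_space) n :
  (forall t, nowhere_dense (F t)) ->
  exists y m, (n < m)%N /\
    forall t, t \in r -> cylinder (splice n (s t) y) m `&` F t = set0.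
Proof.
move=> nwF; elim: r => [|t r [y [m [nm IH]]]].
  by exists (fun=> false), n.+1.
have [z [m' [mm' yz zF]]] := nowhere_dense_avoid (splice n (s t) y) m (nwF t).
exists z, m'; split; first exact: leq_trans nm mm'.
move=> u; rewrite inE => /predU1P[->|ur].
  apply/seteqP; split=> // w [wz Fw]; rewrite -zF; split=> // i im'.
  rewrite (wz _ im') /splice; case: ifP => // i_n.
  by rewrite (yz _ (ltn_trans i_n nm)) /splice i_n.
apply/seteqP; split=> // w [wz Fw]; rewrite -(IH u ur); split=> // i im.
rewrite (wz _ (leq_trans im mm')) /splice; case: ifP => // i_n.
by rewrite (yz _ im) /splice i_n.
Qed.

Lemma nowhere_dense_avoid_all (F : nat -> set cantor_space) n k :
  (forall j, nowhere_dense (F j)) ->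
  exists ym : cantor_space * nat, (n < ym.2)%N /\ forall s j, (j <= k)%N ->
    cylinder (splice n s ym.1) ym.2 `&` F j = set0.
Proof.
move=> nwF.
(* Only the first [n] bits of [s] matter, so finitely many pairs of a prefix and an index exhaust
   all requirements. *)
have [y [m [nm ymF]]] := nowhere_dense_avoid_prefixes
  (enum [the finType of (n.-tuple bool * 'I_k.+1)%type])
  (fun t i => nth false t.1 i) n (fun t => nwF (nat_of_ord t.2)).
exists (y, m); split=> // s j jk.
have := ymF ([tuple s (nat_of_ord i) | i < n], Ordinal (jk : (j < k.+1)%N)).
rewrite mem_enum => /(_ isT) /= <-; congr (cylinder _ _ `&` _).
apply/funext => i; rewrite /splice; case: ifP => // i_n.
exact: (esym (nth_mktuple (fun i => s (nat_of_ord i)) false (Ordinal i_n))).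
Qed.

(** The [k]-th pattern avoids [F 0], ..., [F k] whatever bits precede it, so following infinitely
    many patterns avoids every [F j]. *)
Lemma meager_avoid_patterns (F : nat -> set cantor_space) :
  (forall j, nowhere_dense (F j)) ->
  exists (S : nat -> nat) (t : nat -> cantor_space),
    {homo S : m n / (m < n)%N} /\
    forall x : cantor_space,
      (forall N, exists2 k, (N <= k)%N &
        forall i, (S k <= i < S k.+1)%N -> x i = t k i) ->
      forall j, ~ F j x.
Proof.
move=> nwF.
have /choice[step stepP] (nk : nat * nat) :=
  nowhere_dense_avoid_all nk.1 nk.2 nwF.
pose S := fix S k := if k is k'.+1 then (step (S k', k')).2 else 0%N.
exists S, (fun k => (step (S k, k)).1); split.
  by apply: homo_ltn; [exact: ltn_trans|move=> k; exact: (stepP (S k, k)).1].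
move=> x xP j Fx; have [k jk xk] := xP j.
suff : (cylinder (splice (S k) x (step (S k, k)).1) (S k.+1) `&` F j) x.
  by rewrite (stepP (S k, k)).2.
split=> // i iS; rewrite /splice; case: ltnP => // Si.
by apply: xk; rewrite Si.
Qed.

(** * Ideals with the Baire property *)

Lemma homo_interval_inj (S : nat -> nat) i k l : {homo S : m n / (m < n)%N} ->
  (S k <= i < S k.+1)%N -> (S l <= i < S l.+1)%N -> k = l.
Proof.
move=> Slt /andP[ki ik] /andP[li il]; have Sle := ltn_homo_le Slt.
have [/Sle kl|/Sle lk|//] := ltngtP k l.
  by have := leq_trans ik (leq_trans kl li); rewrite ltnn.
by have := leq_trans il (leq_trans lk ki); rewrite ltnn.
Qed.

Lemma interval_glue (S : nat -> nat) (t : nat -> nat -> bool) :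
  {homo S : m n / (m < n)%N} ->
  exists x : nat -> bool, forall k i, (S k <= i < S k.+1)%N -> x i = t k i.
Proof.
move=> Slt.
exists (fun i => `[< exists k, (S k <= i < S k.+1)%N /\ t k i >]) => k i ki.
apply/asboolP/idP => [[l [li tl]]|tk]; last by exists k.
by rewrite (homo_interval_inj Slt ki li).
Qed.

(* If the ideal were comeager in a cylinder, then some x and its flip beyond
   the cylinder's length would both lie in it: let x follow the avoiding
   patterns on even intervals and their negations on odd ones. *)
Lemma baire_ideal_meager (I : set (set nat)) : is_ideal I ->
  baire_property (in_cantor I) ->
  exists2 F : nat -> set cantor_space,
    forall n, nowhere_dense (F n) & in_cantor I `<=` \bigcup_n F n.
Proof.
move=> idealI [U oU [F nwF IUF]]; exists F => //.
suff U0 : U = set0 by rewrite -IUF U0 setD0; exact: subsetUl.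
apply: contrapT => /eqP/set0P[s Us].
have /nbhs_cylinder[n nU] : nbhs s U by exact: open_nbhs_nbhs.
have [S [t [Slt tF]]] := meager_avoid_patterns nwF.
have [x xP] := interval_glue (fun k i => t k i (+) odd k) Slt.
have avoid (b : bool) : I [set i | splice n s (fun i => x i (+) b) i].
  set y := splice _ _ _; apply: contrapT => nIy.
  have Uy : U y by apply: nU => i i_n; rewrite /y /splice i_n.
  have : (\bigcup_j F j) y by rewrite -IUF; right; split.
  (* The chosen interval has an index of parity [b], so both negations cancel and [y] follows the
     pattern; the index is at least [n], which places the interval past the spliced prefix. *)
  move=> [j _]; apply: tF => N; exists ((maxn n N).*2 + b)%N; first by lia.
  move=> i iS; rewrite /y /splice ltnNge.
  have -> : (n <= i)%N.
    move: iS => /andP[+ _]; apply: leq_trans.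
    by apply: leq_trans (ltn_homo_ge_id _ Slt); lia.
  by rewrite /= (xP _ _ iS) oddD odd_double /= oddb -addbA addbb addbF.
apply: (ideal_proper idealI).
apply: (ideal_subset idealI) (ideal_setU idealI (ideal_setU idealI
  (avoid false) (avoid true)) (ideal_finite idealI (finite_II n))).
move=> i _; rewrite /splice /=; case: (ltnP i n) => i_n; first by right.
by left; case: (x i); [left|right].
Qed.

(* The Jalali-Naini--Talagrand theorem. *)
Lemma baire_ideal_intervals (I : set (set nat)) : is_ideal I ->
  baire_property (in_cantor I) ->
  exists2 S : nat -> nat, {homo S : m n / (m < n)%N} &
    forall X : set nat,
      (forall N, exists2 k, (N <= k)%N &
         forall i, (S k <= i < S k.+1)%N -> X i) -> ~ I X.
Proof.
move=> idealI /(baire_ideal_meager idealI)[F nwF IF].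
have [S [t [Slt tF]]] := meager_avoid_patterns nwF.
exists S => // X Xinf IX.
have [x xP] := interval_glue t Slt.
(* Thinning [X] by [x] stays in the ideal and follows the pattern on every interval contained in
   [X]. *)
pose y : cantor_space := fun i => `[< X i >] && x i.
have : in_cantor I y.
  by apply: (ideal_subset idealI _ IX) => i /= /andP[/asboolP].
move=> /IF[j _]; apply: tF => N; have [k Nk kX] := Xinf N.
exists k => // i ki; rewrite /y (xP _ _ ki).
by rewrite (_ : `[< X i >] = true) //; apply/asboolP; exact: kX.
Qed.

(** * The upper bound and the equality *)

Lemma b3_le_star_unbounded (I : set (set nat)) F : is_ideal I ->
  baire_property (in_cantor I) -> star_unbounded F ->
  exists2 E, b3_witness I Fin Fin E & E #<= F.
Proof.
move=> idealI /(baire_ideal_intervals idealI)[S Slt SI] Funb.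
have Sle := ltn_homo_le Slt.
(* Members of [F] may fail to increase, so their majorants delimit the blocks. *)
pose e (f : nat -> nat) i :=
  [set x | (S (majorant f i) <= x < S (majorant f i.+1))%N].
exists (e @` F); last exact: card_image_le.
split=> [_ [f Ff <-]|A [[Afin _] Acov]].
  split=> [n|i j _ _ [x [ix jx]]].
    by apply: (@sub_finite_set _ _ `I_(S (majorant f n.+1))) => // x /andP[].
  apply: (@homo_interval_inj (S \o majorant f) x) => // m n mn.
  exact/Slt/majorant_homo.
have [h hP] := finite_seq_bounded Afin.
apply: contrapT => noe; apply: Funb; exists h => f Ff.
apply: contrapT => /not_le_star hf; apply: noe.
exists (e f); first by exists f.
apply: SI => N; have [i Ni hfi] := hf N.
exists (majorant f i).
  apply: (leq_trans Ni); exact: ltn_homo_ge_id (@majorant_homo f).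
move=> x /andP[Sx xS].
have : (\bigcup_n A n) x by rewrite Acov.
(* If [n < i], then [x < h i < f i < majorant f i <= S (majorant f i) <= x], which is absurd; hence
   [i <= n]. *)
move=> [n _ Anx]; exists n => //; split=> //; exists i => /=.
  rewrite leqNgt; apply/negP => /ltnW/hP/(_ Anx).
  rewrite ltnNge => /negP; apply.
  apply: ltnW; apply: (ltn_trans hfi); apply: (leq_trans (majorant_gt f i)).
  by apply: leq_trans Sx; exact: ltn_homo_ge_id.
rewrite /e /= Sx /=; apply: (leq_trans xS); apply: Sle; exact: majorant_homo.
Qed.

Theorem theorem6p3 (I : set (set nat)) (idealI : is_ideal I)
  (baireI : baire_property (in_cantor I)) :
  exists k : set (nat -> nat), is_b3 I Fin Fin k /\ is_b k.
Proof.
have [B Bunb Bmin] :=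
  ex_min_card (ex_intro _ [set: nat -> nat] star_unboundedT).
have [E Ewit EB] := b3_le_star_unbounded idealI baireI Bunb.
(* Every witness is at least as large as some unbounded family, hence as [B]; so [E], of size at
   most that of [B], is a least witness. *)
have Blow E' : b3_witness I Fin Fin E' -> B #<= E'.
  move=> /(star_unbounded_le_b3 idealI)[F /Bmin BF]; exact: card_le_trans.
exists B; split; last by exists B; split => //; exact: card_eqxx.
left; exists E; split=> // [E' /Blow|].
  exact: card_le_trans.
by rewrite card_eq_le EB Blow.
Qed.
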